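(* There is no exchange ring $R$ with finite stable rank such that $S_{\omega_1}$ is isomorphic to the semilattice of all compact idempotent-generated ideals of $R$.
   Context: Rings are associative and unital. A ring $R$ is an exchange ring if for every $x\in R$ there is an idempotent $f\in xR$ with $1-f\in(1-x)R$. Ideals are two-sided; compact means finitely generated (as a two-sided ideal), and an ideal is idempotent-generated if it is generated, as a two-sided ideal, by idempotents of $R$. The compact idempotent-generated ideals of $R$ form a join-semilattice with zero under inclusion (join is the sum of ideals). Finite stable rank means finite Bass stable rank. For exchange rings, $R$ has stable rank at most $k$ iff the isomorphism class $e=[R]$ has stable rank at most $k$ in the commutative monoid $V(R)$ of isomorphism classes of finitely generated projective right $R$-modules (addition induced by direct sum), i.e. $ke+a=e+b$ implies $a\leq b$ for all $a,b\in V(R)$, where $x\leq y$ iff $x+z=y$ for some $z\in V(R)$. Here $k$ is a positive integer. The semilattice $S_{\omega_1}$: ordinals are identified with the set of smaller ordinals. Let $\mathcal{B}_{\omega_1}$ be the Boolean subalgebra of the powerset of $\omega_1$ generated by all intervals of $\omega_1$. Put $\mathcal{I}_{\omega_1}=\{x\in\mathcal{B}_{\omega_1}\mid \exists\alpha<\omega_1,\ x\subseteq\alpha\}$, $\mathcal{F}_{\omega_1}=\{x\in\mathcal{B}_{\omega_1}\mid \exists\alpha<\omega_1,\ \omega_1\setminus\alpha\subseteq x\}$, $D_{\omega_1}=\{x\subseteq\omega_1\mid x\text{ is finite or }x=\omega_1\}$, and $D_{\omega_1}^-=D_{\omega_1}\setminus\{\varnothing\}$. Then $S_{\omega_1}=(\{\varnothing\}\times\mathcal{I}_{\omega_1})\cup(D_{\omega_1}^-\times\mathcal{F}_{\omega_1})$,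 ordered by componentwise inclusion; it is a distributive join-semilattice with $0$ and $1$ (joins are componentwise unions). *)

(* Defs.v *)
From HB Require Import structures.
From mathcomp Require Import all_boot all_order all_algebra.
From mathcomp Require Import boolp classical_sets functions cardinality.
From mathcomp Require wochoice.

Set Implicit Arguments.
Unset Strict Implicit.
Unset Printing Implicit Defensive.

Import Order.TTheory GRing.Theory.
Local Open Scope classical_set_scope.
Local Open Scope order_scope.
Local Open Scope ring_scope.

Section Rings.
Variable R : pzRingType.
Implicit Types (x : R) (I J A : set R).

(* [idempotent] is a MathComp notation about binary operations. *)
Definition idempotent_elt x := x * x = x.

Definition exchange_ring := forall x, exists f : R,
  [/\ idempotent_elt f, exists r, f = x * r & exists s, 1 - f = (1 - x) * s].

Definition right_unimodular n (a : 'I_n -> R) :=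
  exists x : 'I_n -> R, \sum_(i < n) a i * x i = 1.

(* Bass's condition: whenever a_0 R + ... + a_k R = R, there are b_i such that
   the k elements a_i + a_k b_i (i < k) still generate R as a right ideal. *)
Definition bass_stable_rank_le (k : nat) :=
  forall a : 'I_k.+1 -> R, right_unimodular a ->
  exists b : 'I_k -> R,
    right_unimodular (fun i : 'I_k => a (widen_ord (leqnSn k) i) + a ord_max * b i).

Definition finite_stable_rank :=
  exists k : nat, (0 < k)%N /\ bass_stable_rank_le k.

(* Closure under opposite follows from closure under multiplication by -1. *)
Definition two_sided_ideal I :=
  [/\ I 0, forall x y, I x -> I y -> I (x + y)
    & forall r x, I x -> I (r * x) /\ I (x * r)].

Definition ideal_generated_by A : set R := smallest two_sided_ideal A.

Definition compact_ideal I :=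
  exists A, finite_set A /\ I = ideal_generated_by A.

Definition idempotent_generated I :=
  exists E, E `<=` idempotent_elt /\ I = ideal_generated_by E.

Definition compact_idempotent_generated_ideals : set (set R) :=
  [set I | compact_ideal I /\ idempotent_generated I].

Definition ideal_sum I J : set R := [set x + y | x in I & y in J].

End Rings.

(* Up to a unique isomorphism, the ordinal omega_1. *)
Definition is_omega1 d (W : orderType d) :=
  [/\ well_founded (fun a b : W => a < b)%O,
      ~ countable [set: W]
    & forall a : W, countable [set b : W | (b < a)%O]].

(* Existence of a model: in a well-ordering of the powerset of nat, the elements
   with countably many predecessors. *)
Module Omega1Model.
Section Omega1Exists.

Let T : choiceType := set nat.
Let le : rel T := sval (wochoice.well_ordering_principle T).

Let le_wo : wochoice.well_order le.
Proof. exact: svalP (wochoice.well_ordering_principle T). Qed.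

Let le_min (A : set T) : A !=set0 ->
  exists m, A m /\ forall x, A x -> le m x.
Proof.
move=> [x0 Ax0]; have [|m [[Am lem] _]] := @le_wo [pred x | `[< A x >]].
  by exists x0; apply/asboolP.
exists m; split; first exact/asboolP.
by move=> x Ax; apply: lem; apply/asboolP.
Qed.

Let le_total : total le.
Proof.
move=> x y; have [|m [mxy lem]] := @le_min [set x; y]; first by exists x; left.
by case: mxy => <-; rewrite lem ?orbT //; [right|left].
Qed.

Let le_anti : antisymmetric le.
Proof.
move=> x y /andP[xy yx].
apply: (@wochoice.wo_chain_antisymmetric _ le xpredT) => //; last by rewrite xy.
by move=> A _; exact: le_wo.
Qed.

Let le_refl : reflexive le.
Proof. by move=> x; have := le_total x x; rewrite orbb. Qed.

Let le_trans : transitive le.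
Proof.
move=> y x z xy yz.
have [|m [[[mE|mE]|mE] lem]] := @le_min [set x; y; z]; first by exists x; do 2 left.
- by rewrite -mE lem //; right.
- have -> : x = y by apply: le_anti; rewrite xy -mE lem //; do 2 left.
  exact: yz.
- have yzE : y = z by apply: le_anti; rewrite yz -mE lem //; left; right.
  by rewrite -yzE.
Qed.

Definition wo_powerset_nat : Type := set nat.
HB.instance Definition _ := Choice.on wo_powerset_nat.
HB.instance Definition _ := Order.Le_isPOrder.Build (Order.Disp tt tt)
  wo_powerset_nat le_refl le_anti le_trans.
HB.instance Definition _ := Order.POrder_isTotal.Build (Order.Disp tt tt)
  wo_powerset_nat le_total.

Definition countable_below (x : wo_powerset_nat) :=
  `[< countable [set y : wo_powerset_nat | (y < x)%O] >].

Definition omega1_model : Type := {x : wo_powerset_nat | countable_below x}.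
HB.instance Definition _ := SubChoice.on omega1_model.
HB.instance Definition _ := [SubChoice_isSubOrder of omega1_model by <:
  with (Order.Disp tt tt)].

Lemma omega1_model_wf : well_founded (fun a b : omega1_model => (a < b)%O).
Proof.
move=> a; apply: contrapT => Na.
have [|m [[b [Nb <-]] lem]] :=
    @le_min [set x | exists b : omega1_model, 
      ~ Acc (fun a b : omega1_model => (a < b)%O) b /\ val b = x].
  by exists (val a), a.
apply: Nb; constructor => c cb; apply: contrapT => Nc.
have bc : (b <= c)%O by apply: lem; exists c.
by move: cb; rewrite ltNge bc.
Qed.

Lemma omega1_model_below (a : omega1_model) :
  countable [set b : omega1_model | (b < a)%O].
Proof.
have /asboolP/countable_injP [f f_inj] := valP a.
apply/countable_injP; exists (f \o val) => b c; rewrite !inE => ba ca fbc.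
by apply: val_inj; apply: f_inj; rewrite ?inE.
Qed.

Lemma omega1_model_uncountable : ~ countable [set: omega1_model].
Proof.
move=> /countable_injP [f f_inj].
have sub_count (A : set wo_powerset_nat) :
    (forall x, A x -> countable_below x) -> countable A.
  move=> sAC; apply/countable_injP.
  exists (fun x => if insub x is Some b then f b else 0%N) => x y.
  rewrite !inE => /sAC Cx /sAC Cy; rewrite !insubT => fxy.
  by have [] := f_inj _ _ (mem_set I) (mem_set I) fxy.
have [allC|] := pselect (forall x, countable_below x).
  have /countable_injP [g g_inj] : countable [set: set nat].
    exact: (sub_count setT (fun x _ => allC x)).
  pose D : set nat := [set n | exists A : set nat, g A = n /\ ~ A n].
  have ND : ~ D (g D).
    move=> gD; case: (gD) => A [gA NA].
    by apply: NA; rewrite (g_inj _ _ (mem_set I) (mem_set I) gA).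
  by apply: (ND); exists D.
move=> /existsNP /(@le_min [set x | ~ countable_below x]) [m [Nm lem]].
apply: Nm; apply/asboolP; apply: sub_count => x /= xm.
apply: contrapT => Nx; have mx : ((m : wo_powerset_nat) <= x)%O by exact: lem.
by move: xm; rewrite ltNge mx.
Qed.

End Omega1Exists.

Lemma omega1_model_is_omega1 : is_omega1 omega1_model.
Proof.
split; [exact: omega1_model_wf | exact: omega1_model_uncountable |].
exact: omega1_model_below.
Qed.

End Omega1Model.

Section SOmega1.
Variables (d : Order.disp_t) (W : orderType d).
Implicit Types (a : W) (x : set W) (C : set (set W)).

(* The ordinal a, identified with the set of smaller ordinals. *)
Definition below a : set W := [set b | (b < a)%O].

Definition boolean_subalgebra C :=
  [/\ C [set: W], forall x, C x -> C (~` x)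
    & forall x y, C x -> C y -> C (x `|` y)].

Definition B_omega1 : set (set W) :=
  smallest boolean_subalgebra (range (fun i : interval W => [set` i])).

Definition I_omega1 : set (set W) :=
  [set x | B_omega1 x /\ exists a, x `<=` below a].

Definition F_omega1 : set (set W) :=
  [set x | B_omega1 x /\ exists a, ~` below a `<=` x].

Definition D_omega1 : set (set W) := [set x | finite_set x \/ x = [set: W]].

Definition D_omega1_minus : set (set W) := D_omega1 `\ set0.

Definition S_omega1 : set (set W * set W) :=
  ([set set0] `*` I_omega1) `|` (D_omega1_minus `*` F_omega1).

Definition S_join (p q : set W * set W) : set W * set W :=
  (p.1 `|` q.1, p.2 `|` q.2).

End SOmega1.

Definition semilattice_isomorphic T U (A : set T) (joinA : T -> T -> T)
    (B : set U) (joinB : U -> U -> U) :=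
  exists f : T -> U, set_bij A B f /\
    forall x y, A x -> A y -> f (joinA x y) = joinB (f x) (f y).

(* Main.v *)
(** Let [f] be the isomorphism. For a point [y] of omega_1 let [P_y] be the proper
    ideal [f (omega_1, omega_1 \ {y})]. For each [x], compactness gives an idempotent
    [u_x] of [R] with class [({x}, F)] where [F] contains a final segment [[a, omega_1)].
    For every [c], the ideals of [u_x] and of [(omega_1, omega_1 \ [a, c))] add up
    to [R], so that 1 is, modulo all [P_y] with [a <= y < c], a sum of [N] terms
    [v * u_x * w]. As countable sets are bounded, some [N = N_x] works for all
    [y >= a], and some [N] is shared by infinitely many [x].

    The ideals of [({x}, omega_1)] and [({x'}, omega_1)] meet below the classes
    [(0, z)] with [z] bounded. Hence the exchange property replaces any finite
    number [m] of the [u_x] by orthogonal idempotents, at no cost modulo [P_y]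
    for [y] large. Modulo such a [P_y], [R^m] is then a direct summand of [R^N]
    for fixed [N] and arbitrary [m], and stable rank at most [k] forbids this as
    soon as [m > N * k]. *)

Require Import Defs.
From HB Require Import structures.
From mathcomp Require Import all_boot all_order all_algebra.
From mathcomp Require Import boolp classical_sets functions cardinality.

Set Implicit Arguments.
Unset Strict Implicit.
Unset Printing Implicit Defensive.

Import Order.TTheory GRing.Theory.
Local Open Scope classical_set_scope.
Local Open Scope ring_scope.

(** * Bass stable rank for matrices *)

Section StableRank.
Variables (R : pzRingType) (k : nat).
Hypothesis srR : bass_stable_rank_le R k.

(** Here [t] is the last element in Bass's condition, with coefficient 1; the terms of a longer tail
    can be collected in it. *)
Lemma stable_rank_row (c : 'rV[R]_k) (t : 'M[R]_1) (x : 'cV[R]_k) :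
  c *m x + t = 1%:M ->
  exists (b : 'rV[R]_k) (g : 'cV[R]_k), (c + t *m b) *m g = 1%:M.
Proof.
move=> cxt.
have widenE (i : 'I_k) : widen_ord (leqnSn k) i = lift ord_max i.
  by apply/val_inj; rewrite /= /bump leqNgt ltn_ord.
pose a (i : 'I_k.+1) := if unlift ord_max i is Some j then c 0 j else t 0 0.
have aw i : a (widen_ord (leqnSn k) i) = c 0 i by rewrite /a widenE liftK.
have am : a ord_max = t 0 0 by rewrite /a unlift_none.
have [|b [g abg]] := @srR a.
  pose y (i : 'I_k.+1) := if unlift ord_max i is Some j then x j 0 else 1.
  exists y; rewrite big_ord_recr /= am /y unlift_none mulr1.
  have := congr1 (fun M : 'M_1 => M 0 0) cxt; rewrite !mxE eqxx => /= cxt1.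
  rewrite -[RHS]cxt1.
  by congr (_ + _); apply: eq_bigr => i _; rewrite aw widenE liftK.
exists (\row_i b i), (\col_i g i); apply/matrixP => i j.
rewrite !ord1 !mxE eqxx -[RHS]abg; apply: eq_bigr => l _.
by rewrite aw am !mxE big_ord_recl big_ord0 addr0 !mxE.
Qed.

(* [IH] is the conclusion of [stable_rank_mx] for [N] rows and width [l]. Stable
   rank makes the first row of [C1] unimodular, which allows clearing the first
   rows of [C2] and [D]; the columns of [C1] in the kernel of its first row join
   [D] when [IH] is applied to the last [N] rows. *)
Lemma stable_rank_mx_step N l p (C1 : 'M[R]_(1 + N, k)) (C2 : 'M[R]_(1 + N, l))
    (D : 'M[R]_(1 + N, p)) X1 X2 Y :
    (forall q (D' : 'M[R]_(N, q)) C' X' Y',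
      C' *m X' + D' *m Y' = 1%:M ->
      exists (E : 'M[R]_(q, l)) Z, (C' + D' *m E) *m Z = 1%:M) ->
    C1 *m X1 + (C2 *m X2 + D *m Y) = 1%:M ->
  exists E1 E2 Z1 Z2, (C1 + D *m E1) *m Z1 + (C2 + D *m E2) *m Z2 = 1%:M.
Proof.
move=> IH XY.
pose c2 := usubmx C2; pose d := usubmx D.
pose x2 := lsubmx X2; pose y := lsubmx Y.
have [] := @stable_rank_row (usubmx C1) (c2 *m x2 + d *m y) (lsubmx X1).
  have := congr1 (fun M => lsubmx (usubmx M)) XY.
  rewrite scalar_mx_block block_mxEv col_mxKu row_mxKl => <-.
  by rewrite !linearD /= -!mul_usub_mx -!mulmx_lsub.
move=> b [g].
pose C1' := C1 + (C2 *m x2 + D *m y) *m b.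
have <- : usubmx C1' = usubmx C1 + (c2 *m x2 + d *m y) *m b.
  by rewrite !linearD /= -!mul_usub_mx linearD /= -!mul_usub_mx.
set c1 := usubmx C1' => c1g.
have [P PE] : {P | P = C1' *m g} by eexists.
have Pu : usubmx P = 1%:M by rewrite PE -mul_usub_mx.
have [C2' C2E] : {M | M = C2 - P *m c2} by eexists.
have [D1 D1E] : {M | M = D - P *m d} by eexists.
have [D2 D2E] : {M | M = C1' - P *m c1} by eexists.
have clear_row q (M : 'M[R]_(1 + N, q)) : usubmx (M - P *m usubmx M) = 0.
  by rewrite linearB /= -mul_usub_mx Pu mul1mx subrr.
have C2u : usubmx C2' = 0 by rewrite C2E clear_row.
have D1u : usubmx D1 = 0 by rewrite D1E clear_row.
have D2u : usubmx D2 = 0 by rewrite D2E clear_row.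
pose X2' := X2 - x2 *m b *m X1; pose Y' := Y - y *m b *m X1.
pose X1' := X1 + g *m (c2 *m X2' + d *m Y').
have id0 : C1' *m X1 + (C2 *m X2' + D *m Y') = 1%:M.
  rewrite -XY mulmxDl -addrA; congr (_ + _).
  rewrite !mulmxBr addrACA -opprD addrCA !mulmxA -!mulmxDl subrr addr0.
  by [].
have id1 : C1' *m X1' + (C2' *m X2' + D1 *m Y') = 1%:M.
  rewrite -id0 mulmxDr -addrA; congr (_ + _).
  by rewrite C2E D1E !mulmxBl addrACA -opprD -!mulmxA -mulmxDr PE -mulmxA addrC subrK.
clearbody X1' X2' Y'.
have c1X : c1 *m X1' = row_mx 1%:M 0.
  have := congr1 usubmx id1; rewrite !linearD /= -!mul_usub_mx.
  by rewrite C2u D1u !mul0mx !addr0 scalar_mx_block block_mxEv col_mxKu.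
(* This is the lower right block of [id1]: the right part of [c1 *m X1'] is 0, so [D2] may replace
   [C1'] there. *)
have low : dsubmx C2' *m rsubmx X2' +
    row_mx (dsubmx D1) (dsubmx D2) *m col_mx (rsubmx Y') (rsubmx X1') = 1%:M.
  rewrite mul_row_col addrA addrC.
  have := congr1 (fun M => dsubmx (rsubmx M)) id1.
  rewrite [in RHS]scalar_mx_block block_mxEh row_mxKr col_mxKd => <-.
  rewrite !linearD /= -!mulmx_rsub -!mul_dsub_mx; congr (_ + _).
  rewrite !mul_dsub_mx !mulmx_rsub D2E mulmxBl -mulmxA c1X !linearB /=.
  by rewrite -(mulmx_rsub P) row_mxKr mulmx0 linear0 subr0.
have [E [Z]] := IH _ _ _ _ _ low.
rewrite -[E]vsubmxK mul_row_col; set E1 := usubmx E; set E2 := dsubmx E => EZ.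
pose G := C2' + (D1 *m E1 + D2 *m E2).
have GZ : G *m Z = col_mx 0 1%:M.
  rewrite -[LHS]vsubmxK -mul_usub_mx -mul_dsub_mx !linearD /= -!mul_usub_mx.
  by rewrite -!mul_dsub_mx C2u D1u D2u !mul0mx !addr0 mul0mx EZ.
pose H := - (g *m c2) - g *m (d *m E1) + (E2 - g *m (c1 *m E2)).
have GE : G = C2 + D *m E1 + C1' *m H.
  rewrite /G /H C2E D1E D2E PE !mulmxDr !mulmxBl !mulmxN !mulmxA -!addrA; congr (_ + _).
  exact: addrCA.
(* The column [P = C1' *m g] and the columns of [G *m Z] form a lower unitriangular matrix; [Q1] and
   [Q2] come from its inverse. *)
pose Q1 := g *m row_mx 1%:M (0 : 'rV_N).
pose Q2 := Z *m row_mx (- dsubmx P) 1%:M.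
have id2 : C1' *m Q1 + G *m Q2 = 1%:M.
  rewrite !mulmxA GZ -PE -[P]vsubmxK Pu !mul_col_mx !mul1mx !mul0mx.
  rewrite col_mxKd mul_mx_row mulmx1 mulmx0 add_col_mx addr0 add_row_mx.
  by rewrite addrN add0r -block_mxEv -scalar_mx_block.
have [K KE] : {K | K = Q1 + H *m Q2} by eexists.
(* [C1'] involves multiples of the columns of [C2], which adding columns of [D] cannot produce. They
   are traded for multiples of the columns of [C2 + D *m E1], absorbed in the second right factor;
   [V] collects the multiples of [D]. *)
have [V VE] : {V | V = y *m b - E1 *m (x2 *m b)} by eexists.
have {}VE : C1 + D *m V + (C2 + D *m E1) *m (x2 *m b) = C1'.
  rewrite VE /C1' -addrA; congr (_ + _).
  by rewrite mulmxBr !mulmxDl !mulmxA addrACA addNr addr0 addrC.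
exists V, E1, K, (x2 *m b *m K + Q2).
rewrite mulmxDr addrA (mulmxA _ (x2 *m b)) -mulmxDl VE.
rewrite KE mulmxDr -addrA -id2; congr (_ + _).
by rewrite GE [RHS]mulmxDl addrC mulmxA.
Qed.

(** Induction on the rows, each of which uses up its own block of [k] columns. The width [p] is
    general because the step enlarges [D]. *)
Lemma stable_rank_mx N p (C : 'M[R]_(N, N * k)) (D : 'M[R]_(N, p)) X Y :
  C *m X + D *m Y = 1%:M ->
  exists (E : 'M[R]_(p, N * k)) Z, (C + D *m E) *m Z = 1%:M.
Proof.
elim: N p C D X Y => [|N IHN] p C D X Y.
  by exists 0, 0; apply/matrixP; case.
rewrite -[(N.+1 * k)%N]/(k + N * k)%N -[N.+1]/(1 + N)%N in C D X Y *.
rewrite -[C]hsubmxK -[X]vsubmxK mul_row_col -addrA.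
case/stable_rank_mx_step=> [q D' C' X' Y'|E1 [E2 [Z1 [Z2 EZ]]]].
  exact: IHN.
exists (row_mx E1 E2), (col_mx Z1 Z2).
by rewrite mul_mx_row add_row_mx mul_row_col.
Qed.

End StableRank.

(** * Stable rank modulo an ideal *)

Section MatrixCongruence.
Variables (R : pzRingType) (I : set R).
Hypothesis idI : two_sided_ideal I.

Lemma idealD x y : I x -> I y -> I (x + y).
Proof. by case: idI => _ + _; exact. Qed.

Lemma ideal_mull r x : I x -> I (r * x).
Proof. by case: idI => _ _ M /(M r)[]. Qed.

Lemma ideal_mulr r x : I x -> I (x * r).
Proof. by case: idI => _ _ M /(M r)[]. Qed.

Lemma idealN x : I x -> I (- x).
Proof. by rewrite -mulN1r; exact: ideal_mull. Qed.

Lemma idealB x y : I x -> I y -> I (x - y).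
Proof. by move=> Ix /idealN; exact: idealD. Qed.

Lemma ideal_summ (T : finType) (F : T -> R) :
  (forall i, I (F i)) -> I (\sum_i F i).
Proof. by move=> IF; elim/big_ind: _ => //; [case: idI|exact: idealD]. Qed.

Definition mx_in m n (A : 'M[R]_(m, n)) := forall i j, I (A i j).

Lemma mx_inD m n (A B : 'M_(m, n)) : mx_in A -> mx_in B -> mx_in (A + B).
Proof. by move=> IA IB i j; rewrite mxE; apply: idealD. Qed.

Lemma mx_inN m n (A : 'M_(m, n)) : mx_in A -> mx_in (- A).
Proof. by move=> IA i j; rewrite mxE; apply: idealN. Qed.

Lemma mx_inMl m n p (A : 'M_(m, n)) (B : 'M_(n, p)) :
  mx_in B -> mx_in (A *m B).
Proof.
by move=> IB i j; rewrite mxE; apply: ideal_summ => l; exact: ideal_mull.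
Qed.

Lemma mx_inMr m n p (A : 'M_(m, n)) (B : 'M_(n, p)) :
  mx_in A -> mx_in (A *m B).
Proof.
by move=> IA i j; rewrite mxE; apply: ideal_summ => l; exact: ideal_mulr.
Qed.

(* As [C Y + (1 - C Y) = 1], some [C + (1 - C Y) E] has a right inverse [Z], and
   multiplying by [Y] shows that [Z] is congruent to [Y]; so [x] is congruent to
   [(C + (1 - C Y) E) Y x], that is, to 0. *)
Lemma stable_rank_mx_inv_proper k N (C : 'M[R]_(N, N * k)) (x : 'cV_N)
    (Y : 'M_(N * k, N)) (y : 'rV_N) :
    bass_stable_rank_le R k ->
    mx_in (Y *m C - 1%:M) -> mx_in (Y *m x) -> mx_in (y *m x - 1%:M) ->
  I 1.
Proof.
move=> srR IYC IYx Iyx.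
pose D := 1%:M - C *m Y.
have [|E [Z CEZ]] := @stable_rank_mx R k srR N N C D Y 1%:M.
  by rewrite mulmx1 addrC subrK.
have IYD : mx_in (Y *m D).
  rewrite (_ : Y *m D = - ((Y *m C - 1%:M) *m Y)); first exact/mx_inN/mx_inMr.
  by rewrite mulmxBr mulmx1 mulmxBl mul1mx opprB mulmxA.
have IZY : mx_in (Z - Y).
  have -> : Z - Y = - ((Y *m C - 1%:M) *m Z) - Y *m D *m (E *m Z).
    rewrite mulmxBl mul1mx opprB -addrA; congr (_ + _).
    rewrite -[in LHS](mulmx1 Y) -CEZ mulmxDl mulmxDr opprD.
    by rewrite !mulmxA.
  by apply: mx_inD; apply: mx_inN; apply: mx_inMr.
have Ix : mx_in x.
  rewrite -[x]mul1mx -CEZ -mulmxA; apply: mx_inMl.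
  by rewrite -[Z](subrK Y) mulmxDl; apply: mx_inD => //; exact: mx_inMr.
have := @mx_inMl _ _ _ y _ Ix 0 0; move/idealB => /(_ _ (Iyx 0 0)).
by rewrite !mxE opprB addrC subrK eqxx.
Qed.

(** The hypothesis makes the free module of rank [N * k + 1] a summand of the one of rank [N] modulo
    [I]. The surplus coordinate, that is, the last column of [A] and the last row of [B], provides
    [x] and [y] above. *)
Lemma stable_rank_no_embedding k N (B : 'M[R]_(N * k + 1, N)) A :
  bass_stable_rank_le R k -> mx_in (B *m A - 1%:M) -> I 1.
Proof.
move=> srR; rewrite -[A]hsubmxK -[B]vsubmxK mul_col_row scalar_mx_block.
rewrite opp_block_mx add_block_mx => IBA.
apply: (@stable_rank_mx_inv_proper k N (lsubmx A) (rsubmx A) (usubmx B)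
  (dsubmx B)) => // i j.
- by have := IBA (lshift _ i) (lshift _ j); rewrite block_mxEul.
- by have := IBA (lshift _ i) (rshift _ j); rewrite block_mxEur subr0.
- by have := IBA (rshift _ i) (rshift _ j); rewrite block_mxEdr.
Qed.

End MatrixCongruence.

(** * Orthogonalizing idempotents by exchange *)

Section Orthogonalization.
Variable R : pzRingType.

(* Decompose [u = h + p] by exchange in the corner [u R u], where [h] lies in
   [u (1 - s) u R]; then [h = a * b] with [b * a] in the corner of [1 - s]. *)
Lemma exchange_orthogonal (s u : R) :
    exchange_ring R -> idempotent_elt s -> idempotent_elt u ->
  exists p a g b : R, [/\ idempotent_elt p /\ idempotent_elt g,
    u = p + a * g * b, (exists v w, p = v * s * w) /\ (exists v, p = v * u),
    exists v w, g = v * u * w & s * g = 0 /\ g * s = 0].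
Proof.
move=> exR ss uu.
pose w := 1 - s.
have ws : w * s = 0 by rewrite mulrBl mul1r ss subrr.
have sw : s * w = 0 by rewrite mulrBr mulr1 ss subrr.
have ww : w * w = w by rewrite {1}/w mulrBl mul1r sw subr0.
have [f [ff [r fE] [t f1E]]] := exR (u * w * u).
have uf : u * f = f by rewrite fE !mulrA uu.
(* Exchange only puts [f] in [u R]; multiplying by [u] moves it to the corner [u R u] and keeps it
   idempotent. *)
have [h hE] : {h | h = f * u} by eexists.
have hh : h * h = h by rewrite hE -mulrA (mulrA u) uf mulrA ff.
have uh : u * h = h by rewrite hE mulrA uf.
have hu : h * u = h by rewrite hE -mulrA uu.
pose a := h * u * w; pose b := w * u * r * u * h.
have abE : a * b = h.
  rewrite /a /b !mulrA -(mulrA _ w w) ww.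
  have -> : h * u * w * u * r * u * h = h * (u * w * u * r) * u * h.
    by rewrite !mulrA.
  by rewrite -fE -(mulrA h) -hE hh hh.
have ha : h * a = a by rewrite /a !mulrA hh.
have bh : b * h = b by rewrite /b -mulrA hh.
exists (u - h), a, (b * a), b; split.
- split; rewrite /idempotent_elt.
    by rewrite mulrBl !mulrBr uu uh hu hh subrr subr0.
  by rewrite mulrA -(mulrA b a b) abE bh.
- by rewrite (mulrA a b a) abE -mulrA abE hh subrK.
- split; last by exists (1 - f); rewrite hE mulrBl mul1r.
  exists u, (u * t * u).
  have -> : u - h = u * (1 - f) * u by rewrite mulrBr mulr1 mulrBl uu uf hE.
  (* The complement of [u * w * u] in the corner of [u] is [u * s * u], which is how [s] enters
     [p]. *)
  have usu : u * (1 - u * w * u) = u * s * u.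
    rewrite mulrBr mulr1 !mulrA uu /w mulrBr mulr1 mulrBl uu opprB addrC.
    by rewrite subrK.
  by rewrite f1E (mulrA u _ t) usu !mulrA.
- exists (w * u * r), (h * a); rewrite /b !mulrA.
  by [].
- split; first by rewrite /b !mulrA sw !mul0r.
  by rewrite /a -!mulrA ws !mulr0.
Qed.

End Orthogonalization.

(** * Generated ideals and sums of ideals *)

Section GeneratedIdeals.
Variable R : pzRingType.
Implicit Types (A I J : set R) (u x : R).

Lemma ideal_generated_is_ideal A : two_sided_ideal (ideal_generated_by A).
Proof.
split=> [I [[]]//|x y Ax Ay I AI|r x Ax].
  by case: (AI) => idI _; apply: (idealD idI); [exact: Ax|exact: Ay].
split=> I AI; case: (AI) => idI _.
  by apply: (ideal_mull idI); exact: Ax.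
by apply: (ideal_mulr idI); exact: Ax.
Qed.

Lemma ideal_generated1_sum u x : ideal_generated_by [set u] x ->
  exists N (v w : 'I_N -> R), x = \sum_i v i * u * w i.
Proof.
move=> ux.
have [s ->] : exists s : seq (R * R), x = \sum_(q <- s) q.1 * u * q.2.
  pose J := [set x | exists s : seq (R * R), x = \sum_(q <- s) q.1 * u * q.2].
  apply: (ux J); split; last first.
    by move=> _ ->; exists [:: (1, 1)]; rewrite big_seq1 mul1r mulr1.
  split; first by exists [::]; rewrite big_nil.
    by move=> _ _ [s ->] [t ->]; exists (s ++ t); rewrite big_cat.
  move=> r _ [s ->]; split.
    exists [seq (r * q.1, q.2) | q <- s]; rewrite big_map mulr_sumr.
    by apply: eq_bigr => q _; rewrite !mulrA.
  exists [seq (q.1, q.2 * r) | q <- s]; rewrite big_map mulr_suml.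
  by apply: eq_bigr => q _; rewrite !mulrA.
exists (size s), (fun i => (tnth (in_tuple s) i).1),
  (fun i => (tnth (in_tuple s) i).2).
by rewrite big_tnth.
Qed.

Lemma ideal_sum_absorb I J : two_sided_ideal I -> two_sided_ideal J ->
  I `<=` J -> ideal_sum I J = J.
Proof.
move=> idI idJ IJ; apply/seteqP; split=> [_ [x Ix [y Jy <-]]|y Jy].
  by apply: (idealD idJ) => //; exact: IJ.
by exists 0; [case: idI|exists y; rewrite ?add0r].
Qed.

Lemma sub_ideal_sum I J : two_sided_ideal J -> I `<=` ideal_sum I J.
Proof.
by move=> idJ x Ix; exists x => //; exists 0; [case: idJ|rewrite addr0].
Qed.

End GeneratedIdeals.

(** * Countability in omega_1 and membership in [S_omega1] *)

Section Omega1.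
Variables (d : Order.disp_t) (W : orderType d).
Hypothesis omega1W : is_omega1 W.

(** An unbounded sequence would make [W] a countable union of countable initial segments and
    points. *)
Lemma omega1_bounded (x : nat -> W) : exists a, forall n, (x n < a)%O.
Proof.
apply: contrapT => /forallNP unb; case: omega1W => _ ucW cW; apply: ucW.
pose F (q : nat * bool) := if q.2 then below (x q.1) else [set x q.1].
rewrite (_ : setT = \bigcup_q F q).
  apply: bigcup_countable => [|[n []] _]; first exact: countableP.
    exact: cW.
  exact: countable1.
apply/seteqP; split=> // a _; have /existsNP[n /negP] := unb a.
rewrite -leNgt le_eqVlt => /orP[/eqP ->|ax]; first by exists (n, false).
by exists (n, true).
Qed.

Lemma omega1_bounded2 (a b : W) : exists c, (a < c)%O /\ (b < c)%O.
Proof.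
have [c cP] := omega1_bounded (fun n => if n is 0 then a else b).
by exists c; split; [exact: (cP 0%N)|exact: (cP 1%N)].
Qed.

Lemma omega1_inhabited : inhabited W.
Proof.
case: omega1W => _ ucW _; apply: contrapT => NW; apply: ucW.
by rewrite (_ : setT = set0) // -subset0 => x; case: NW.
Qed.

Lemma omega1_infinite_fiber (c : W -> nat) :
  exists N, infinite_set (c @^-1` [set N]).
Proof.
apply: contrapT => /forallNP fin; case: omega1W => _ ucW _; apply: ucW.
rewrite (_ : setT = \bigcup_N (c @^-1` [set N])); last first.
  by apply/seteqP; split=> // x _; exists (c x).
apply: bigcup_countable => // N _; apply: finite_set_countable.
apply: contrapT; exact: fin.
Qed.

Lemma B_omega1_subalgebra : boolean_subalgebra (@B_omega1 d W).
Proof.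
split=> [C [[CT _ _] _] //|x Bx C CC|x y Bx By C CC].
  by case: (CC) => -[_ CN _] _; apply: CN; exact: Bx.
by case: (CC) => -[_ _ CU] _; apply: CU; [exact: Bx|exact: By].
Qed.

Lemma B_omega1_itv (i : interval W) : B_omega1 [set` i].
Proof. by move=> C [_]; apply; exists i. Qed.

Lemma S_omega1_top (q : set W) : D_omega1_minus q -> S_omega1 (q, setT).
Proof.
move=> Dq; right; split=> //; split; first by case: B_omega1_subalgebra.
by have [a] := omega1_inhabited; exists a.
Qed.

Lemma D_omega1_minusT : D_omega1_minus [set: W].
Proof.
split; first by right.
have [a] := omega1_inhabited => /= T0.
by have : [set: W] a by []; rewrite T0.
Qed.

Lemma D_omega1_minus_finite (q : set W) a :
  finite_set q -> q a -> D_omega1_minus q.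
Proof. by move=> finq qa; split; [left|move=> /= q0; rewrite q0 in qa]. Qed.

Lemma S_omega1_setC_itv (i : interval W) a :
  [set` i] `<=` below a -> S_omega1 ([set: W], ~` [set` i]).
Proof.
move=> ia; right; split; first exact: D_omega1_minusT.
split; last by exists a; exact: subsetC.
have [_ BC _] := B_omega1_subalgebra; exact: (BC _ (B_omega1_itv i)).
Qed.

(* In the definition of [S_join], the join symbol is [Order.join] at type [set W],
   which is convertible to [setU]. *)
Lemma S_joinE (s t : set W * set W) :
  S_join s t = (s.1 `|` t.1, s.2 `|` t.2).
Proof. by []. Qed.

Lemma S_omega1_join (s t : set W * set W) :
  S_omega1 s -> S_omega1 t -> S_omega1 (S_join s t).
Proof.
rewrite S_joinE; case: s t => [s1 s2] [t1 t2].
have BU (x y : set W) : B_omega1 x -> B_omega1 y -> B_omega1 (x `|` y).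
  by have [_ _] := B_omega1_subalgebra; exact.
have DU (x y : set W) : D_omega1_minus x -> D_omega1 y ->
    D_omega1_minus (x `|` y).
  move=> [Dx x0] Dy; split; last by rewrite /= setU_eq0 => -[].
  case: Dx Dy => [fx [fy|->]|-> _]; rewrite ?setUT ?setTU; [left|right|right] => //.
  by rewrite finite_setU.
case=> -[/= Ds [Bs [a sa]]] [] -[/= Dt [Bt [b tb]]].
- left; rewrite Ds Dt; split; rewrite /= ?setU0 //; split; first exact (BU _ _ Bs Bt).
  have [c [ac bc]] := omega1_bounded2 a b.
  by exists c => x [/sa|/tb] /= xa; exact: lt_trans xa _.
- right; split=> /=; first by rewrite Ds set0U.
  by split; [exact (BU _ _ Bs Bt)|exists b; apply: subset_trans tb _; exact: subsetUr].
- right; split=> /=; first by rewrite Dt setU0.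
  by split; [exact (BU _ _ Bs Bt)|exists a; apply: subset_trans sa _; exact: subsetUl].
- right; split=> /=; first by apply: DU => //; case: Dt.
  by split; [exact (BU _ _ Bs Bt)|exists a; apply: subset_trans sa _; exact: subsetUl].
Qed.

End Omega1.

(** * Ideals and idempotents of a ring realizing [S_omega1] *)

Section Realization.
Variables (d : Order.disp_t) (W : orderType d) (R : pzRingType).
Hypothesis omega1W : is_omega1 W.
Hypothesis exR : exchange_ring R.
Variable f : set W * set W -> set R.
Hypothesis f_bij :
  set_bij (@S_omega1 d W) (@compact_idempotent_generated_ideals R) f.
Hypothesis f_join : forall s t, S_omega1 s -> S_omega1 t ->
  f (S_join s t) = ideal_sum (f s) (f t).
Implicit Types (s t : set W * set W) (a b : W) (u g : R).

Lemma realization_ideal s : S_omega1 s -> two_sided_ideal (f s).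
Proof.
case: f_bij => f_fun _ _ /f_fun [[A [_ ->]] _].
exact: ideal_generated_is_ideal.
Qed.

(** Only joins are assumed to be preserved. The order is recovered on both sides from the fact that
    [s] is below [t] iff their join is [t], using injectivity of [f]. *)
Lemma realization_le s t : S_omega1 s -> S_omega1 t ->
  f s `<=` f t <-> s.1 `<=` t.1 /\ s.2 `<=` t.2.
Proof.
move=> Ss St; have [idS idT] := (realization_ideal Ss, realization_ideal St).
split=> [st|[/setUidPr st1 /setUidPr st2]]; last first.
  have <- : f (S_join s t) = f t.
    by rewrite S_joinE st1 st2; case: (t).
  by rewrite f_join //; exact: sub_ideal_sum.
have [_ f_inj _] := f_bij.
have /f_inj : f (S_join s t) = f t by rewrite f_join // ideal_sum_absorb.
rewrite !inE => /(_ (S_omega1_join omega1W Ss St) St); rewrite S_joinE => <-.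
by split; exact: subsetUl.
Qed.

Lemma realization_idempotent u : idempotent_elt u ->
  exists2 s, S_omega1 s & f s = ideal_generated_by [set u].
Proof.
move=> uu; have [_ _ f_surj] := f_bij.
have [|s Ss fs] := f_surj (ideal_generated_by [set u]); last by exists s.
by split; exists [set u]; split => // _ ->.
Qed.

Lemma realization_mem s u : S_omega1 s -> f s u ->
  ideal_generated_by [set u] `<=` f s.
Proof.
move=> Ss su; apply: smallest_sub => [|_ ->//].
exact: realization_ideal.
Qed.

Let top := ([set: W], [set: W]).

Let S_top : S_omega1 top.
Proof. exact/S_omega1_top/D_omega1_minusT. Qed.

(** As 1 is idempotent, the ideal it generates is some [f s], and [s] is below [top]. *)
Lemma realization_top : f top = [set: R].
Proof.
apply/seteqP; split=> // x _.
have [s Ss fs] := realization_idempotent (mulr1 1).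
have /(realization_le Ss S_top) le_top : s.1 `<=` top.1 /\ s.2 `<=` top.2.
  by [].
rewrite -[x]mulr1; apply: (ideal_mull (realization_ideal S_top)).
by apply: le_top; rewrite fs; exact: sub_gen_smallest.
Qed.

Let off (i : interval W) := ([set: W], ~` [set` i]).

Let S_off i a : [set` i] `<=` below a -> S_omega1 (off i).
Proof. exact: S_omega1_setC_itv. Qed.

(** The singleton is written as an interval to share [off] with the intervals [[a, c)] used
    below. *)
Definition point_ideal (x : W) : set R := f (off `[x, x]).

Let S_point x : S_omega1 (off `[x, x]).
Proof.
have [c [xc _]] := omega1_bounded2 omega1W x x; apply: (@S_off _ c) => y /=.
by rewrite itvxx inE => /eqP ->.
Qed.

Lemma point_ideal_is_ideal x : two_sided_ideal (point_ideal x).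
Proof. exact: realization_ideal. Qed.

Lemma point_ideal_proper x : ~ point_ideal x 1.
Proof.
move=> Px1; have : f top `<=` f (off `[x, x]).
  move=> r _; rewrite -[r]mulr1.
  exact: (ideal_mull (point_ideal_is_ideal x)).
case/(realization_le S_top (S_point x)) => _ /(_ x I); apply.
by rewrite /= in_itv /= lexx.
Qed.

Let S_finite (q : set W) a : finite_set q -> q a -> S_omega1 (q, setT).
Proof.
move=> finq qa; apply: S_omega1_top => //; exact: (D_omega1_minus_finite finq qa).
Qed.

Lemma S_omega1_set0 (x : set W) : S_omega1 (set0, x) -> I_omega1 x.
Proof. by case=> -[] // -[_ N0] _; case: N0. Qed.

(** Otherwise every idempotent generator of [f ([set x], setT)] has a class [(set0, z)] with [z]
    bounded. The ideals of such classes have a directed union [K], so a finite generating set lies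
    in a single one, against the order of [S_omega1]. *)
Lemma point_idempotent x : exists u, [/\ idempotent_elt u,
    f ([set x], setT) u &
    exists a (F : set W), [/\ S_omega1 ([set x], F),
      f ([set x], F) = ideal_generated_by [set u] & ~` below a `<=` F]].
Proof.
have Sx : S_omega1 ([set x], setT) by exact: (S_finite (finite_set1 x)).
have [f_fun _ _] := f_bij; have [[A [finA fA]] [E [idE fE]]] := f_fun _ Sx.
apply: contrapT => Nu.
pose K := [set r | exists2 y, I_omega1 y & f (set0, y) r].
have S0 (y : set W) : I_omega1 y -> S_omega1 (set0, y) by left.
have BI : I_omega1 (@set0 W).
  split; last by have [a] := omega1_inhabited omega1W; exists a.
  have [BT BC _] := B_omega1_subalgebra W.
  by rewrite -setCT; exact (BC _ BT).
have join0 (y z : set W) : (set0, y `|` z) = S_join (set0, y) (set0, z).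
  by rewrite S_joinE /= setU0.
have IU (y z : set W) : I_omega1 y -> I_omega1 z -> I_omega1 (y `|` z).
  move=> Iy Iz; apply: S_omega1_set0; rewrite join0.
  exact: (S_omega1_join omega1W (S0 _ Iy) (S0 _ Iz)).
have idK : two_sided_ideal K.
  split; first by exists set0 => //; case: (realization_ideal (S0 _ BI)).
    move=> r r' [y Iy yr] [z Iz zr']; exists (y `|` z); first exact: IU.
    rewrite join0 f_join; [|exact: S0|exact: S0].
    by exists r => //; exists r'.
  move=> r r' [y Iy yr']; have [_ _ yM] := realization_ideal (S0 _ Iy).
  by have [] := yM r _ yr'; split; exists y.
have EK : E `<=` K.
  move=> e Ee; have ee := idE e Ee.
  have xe : f ([set x], setT) e by rewrite fE; exact: sub_gen_smallest Ee.
  have [[p F] Ss fs] := realization_idempotent ee.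
  have /(realization_le Ss Sx)/= [px _] : f (p, F) `<=` f ([set x], setT).
    by rewrite fs; exact: realization_mem.
  have [p0|/set0P[y py]] := eqVneq p set0.
    exists F; first by apply: S_omega1_set0; rewrite -p0.
    by rewrite -p0 fs; exact: sub_gen_smallest.
  have pE : p = [set x].
    by apply/seteqP; split=> // _ ->; rewrite -(px _ py).
  case: Nu; exists e; split=> //.
  case: (Ss) => [[/= p0]|[/= _ [_ [a aF]]]]; first by rewrite p0 in py.
  by exists a, F; rewrite -pE.
have AK : A `<=` K.
  apply: subset_trans (smallest_sub idK EK).
  rewrite -[smallest _ _]/(ideal_generated_by E) -fE fA.
  exact: sub_gen_smallest.
have [y Iy Ay] : exists2 y, I_omega1 y & A `<=` f (set0, y).
  have /finite_seqP[l lE] := finA.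
  have lK z : z \in l -> K z by move=> zl; apply: AK; rewrite lE.
  suff [y Iy ly] : exists2 y, I_omega1 y & forall z, z \in l -> f (set0, y) z.
    by exists y => // z; rewrite lE; exact: ly.
  elim: l lK {lE} => [_|z l IH lK]; first by exists set0.
  have [v|y Iy ly] := IH; first by move=> vl; apply: lK; rewrite inE vl orbT.
  have [y' Iy' zy'] := lK z (mem_head _ _).
  exists (y' `|` y) => [|v]; first exact: IU.
  rewrite join0 f_join; [|exact: S0|exact: S0].
  have [[v0 _ _] [v0' _ _]] :=
    (realization_ideal (S0 _ Iy), realization_ideal (S0 _ Iy')).
  rewrite inE => /predU1P[->|/ly vy].
    by exists z => //; exists 0; rewrite ?addr0.
  by exists 0 => //; exists v; rewrite ?add0r.
have /(realization_le Sx (S0 _ Iy)) /= [] : f ([set x], setT) `<=` f (set0, y).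
  by rewrite fA; apply: smallest_sub => //; exact/realization_ideal/S0.
by move=> /(_ x erefl).
Qed.

(** If each [N] failed at some [y N], these points would have a bound [c]; an expression of 1 valid
    on all of [[a, c)] has some length [N], which then works at [y N]. *)
Lemma point_idempotent_bounded x : exists (uaN : R * W * nat),
  let: (u, a, N) := uaN in
  [/\ idempotent_elt u, f ([set x], setT) u &
    forall y, (a <= y)%O -> exists v w : 'I_N -> R,
      point_ideal y (1 - \sum_i v i * u * w i)].
Proof.
have [u [uu xu [a [F [SF fF aF]]]]] := point_idempotent x.
suff [N uN] : exists N, forall y, (a <= y)%O -> exists v w : 'I_N -> R,
    point_ideal y (1 - \sum_i v i * u * w i) by exists (u, a, N).
apply: contrapT => /forallNP NN.
have /choice[y yP] N : exists y, (a <= y)%O /\ forall v w : 'I_N -> R,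
    ~ point_ideal y (1 - \sum_i v i * u * w i).
  have /existsNP[y /not_implyP[ay Ny]] := NN N; exists y; split=> // v w yvw.
  by apply: Ny; exists v, w.
have [c yc] := omega1_bounded omega1W y.
have Sac : S_omega1 (off `[a, c[).
  by apply: (@S_off _ c) => z /=; rewrite in_itv /= => /andP[].
have : f top 1 by rewrite realization_top.
(* [F] contains the interval [[a, c)] that the other second component omits. *)
have -> : top = S_join ([set x], F) (off `[a, c[).
  rewrite S_joinE /= setUT; congr (_, _); apply/esym; rewrite -subTset => z _.
  have [az|/negP Naz] := boolP (a <= z)%O; last first.
    by right; rewrite /= in_itv /=; case/andP.
  by left; apply: aF; rewrite /below /=; apply/negP; rewrite -leNgt.
rewrite f_join // => -[p]; rewrite fF => /ideal_generated1_sum[N [v [w ->]]].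
move=> [q acq pq1]; have [ay] := yP N; case/(_ v w).
have <- : q = 1 - \sum_i v i * u * w i by rewrite -pq1 addrC addKr.
move: q acq {pq1}; apply/(realization_le Sac (S_point (y N))); split=> //=.
by apply: subsetC => z /=; rewrite itvxx inE => /eqP ->; rewrite in_itv /= ay yc.
Qed.

(** The class of [p] has empty first component, so its second component is bounded and omits all
    large [y]. *)
Lemma meet_point_ideal (q r : set W) (p : R) :
    S_omega1 (q, setT) -> S_omega1 (r, setT) -> q `&` r = set0 ->
    idempotent_elt p -> f (q, setT) p -> f (r, setT) p ->
  exists c, forall y, (c <= y)%O -> point_ideal y p.
Proof.
move=> Sq Sr qr0 pp qp rp.
have [[t z] St ft] := realization_idempotent pp.
have /(realization_le St Sq)/= [tq _] : f (t, z) `<=` f (q, setT).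
  by rewrite ft; exact: realization_mem.
have /(realization_le St Sr)/= [tr _] : f (t, z) `<=` f (r, setT).
  by rewrite ft; exact: realization_mem.
have t0 : t = set0 by rewrite -subset0 -qr0 => v tv; split; [exact: tq|exact: tr].
have [_ [c zc]] : I_omega1 z by apply: S_omega1_set0; rewrite -t0.
exists c => y cy.
have /(_ p) : f (t, z) `<=` point_ideal y.
  apply/(realization_le St (S_point y)); split=> //= v /zc /= vc.
  by rewrite itvxx inE => /eqP vy; move: cy; rewrite -vy leNgt vc.
by apply; rewrite ft; exact: sub_gen_smallest.
Qed.

(* The sequence is used from index 1 on: [x 0] only makes the first component of
   the class bounding [s] nonempty when [n = 0]. *)
Lemma realization_orthogonal (x : nat -> W) (u : nat -> R) n :
    injective x -> (forall i, idempotent_elt (u i)) ->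
    (forall i, f ([set x i], setT) (u i)) ->
  exists (s : R) (g a b : nat -> R) (c : W),
    [/\ idempotent_elt s, f (x @` `I_n.+1, setT) s,
      forall i, (i < n)%N -> s * g i = g i /\ g i * s = g i,
      forall i j, (i < n)%N -> (j < n)%N ->
        g i * g j = if i == j then g i else 0 &
      forall i y, (i < n)%N -> (c <= y)%O ->
        point_ideal y (u i.+1 - a i * g i * b i)].
Proof.
move=> x_inj uu xu.
have Sx m : S_omega1 (x @` `I_m.+1, setT).
  apply: (@S_finite _ (x 0%N)); last by exists 0%N.
  exact/finite_image/finite_II.
have Sx1 m : S_omega1 ([set x m], setT) by exact: (S_finite (finite_set1 _)).
elim: n => [|n [s [g [a [b [c [ss xs sg gg uc]]]]]]].
  have [c] := omega1_inhabited omega1W.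
  exists 0, (fun=> 0), (fun=> 0), (fun=> 0), c; split=> //.
    by rewrite /idempotent_elt mulr0.
  by case: (realization_ideal (Sx 0%N)).
have [p [a' [g' [b' [[pp gg'] uE [[v1 [w1 p1]] [v2 p2]] [v3 [w3 g3]]
    [sg' gs']]]]]] := exchange_orthogonal exR ss (uu n.+1).
have idn := realization_ideal (Sx n).
have idn1 := realization_ideal (Sx1 n.+1).
(* [p] is a multiple of both [s] and [u n.+1], whose ideals belong to disjoint finite sets. *)
have [c' pc'] : exists c', forall y, (c' <= y)%O -> point_ideal y p.
  apply: (meet_point_ideal (Sx n) (Sx1 n.+1)) => //.
  - rewrite -subset0 => y [[m /= mn <-] /x_inj mE].
    by rewrite mE ltnn in mn.
  - by rewrite p1; apply: (ideal_mulr idn); apply: (ideal_mull idn).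
  - by rewrite p2; apply: (ideal_mull idn1).
have xg' : f (x @` `I_n.+2, setT) g'.
  have /(_ g') : f ([set x n.+1], setT) `<=` f (x @` `I_n.+2, setT).
    by apply/realization_le => //; split=> // _ ->; exists n.+1 => /=.
  apply; rewrite g3; apply: (ideal_mulr idn1); exact: (ideal_mull idn1).
have {}xs : f (x @` `I_n.+2, setT) s.
  have /(_ s) : f (x @` `I_n.+1, setT) `<=` f (x @` `I_n.+2, setT).
    apply/realization_le => //; split=> //; apply: image_subset => i /=.
    exact: leqW.
  exact.
(* [s] is a two-sided unit for the earlier [g i], so orthogonality to [s] suffices. *)
have gg0 i : (i < n)%N -> g i * g' = 0 /\ g' * g i = 0.
  move=> /sg[sgi gsi]; split; first by rewrite -gsi -mulrA sg' mulr0.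
  by rewrite -sgi mulrA gs' mul0r.
have [e [ce c'e]] := omega1_bounded2 omega1W c c'.
exists (s + g'), (fun i => if i == n then g' else g i),
  (fun i => if i == n then a' else a i), (fun i => if i == n then b' else b i), e.
split.
- by rewrite /idempotent_elt mulrDl !mulrDr ss gg' sg' gs' addr0 add0r.
- by apply: (idealD (realization_ideal (Sx n.+1))).
- move=> i; rewrite ltnS leq_eqVlt; case: eqP => /= [_ _|_ ni].
    by rewrite mulrDl mulrDr sg' gs' gg' !add0r.
  have [[sgi gsi] [gg'i g'gi]] := (sg i ni, gg0 i ni).
  by rewrite mulrDl mulrDr sgi gsi gg'i g'gi !addr0.
- move=> i j; rewrite !ltnS (leq_eqVlt i) (leq_eqVlt j).
  case: (i =P n) => [->|/eqP ni] /=; case: (j =P n) => [->|/eqP nj] //=.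
  + by rewrite eqxx.
  + by move=> _ /gg0[_ ->]; rewrite eq_sym (negPf nj).
  + by move=> /gg0[-> _] _; rewrite (negPf ni).
  + exact: gg.
- move=> i y; rewrite ltnS leq_eqVlt; case: eqP => /= [->|_] ni ey.
    rewrite uE addrK; apply: pc'; exact: le_trans (ltW c'e) ey.
  by apply: uc => //; exact: le_trans (ltW ce) ey.
Qed.

Lemma realization_infinite_stable_rank k : ~ bass_stable_rank_le R k.
Proof.
move=> srR; have /choice[t tP] := point_idempotent_bounded.
have [N /infiniteP] := omega1_infinite_fiber omega1W (fun x => (t x).2).
case/card_leP => h.
pose x n : W := val (h (SigSub (mem_set (I : [set: nat] n)))).
have x_inj : injective x.
  move=> i j /val_inj hij; have := inj (mem_set I) (mem_set I) hij.
  by move/(congr1 val).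
have xN n : (t (x n)).2 = N by exact: set_mem (valP (h _)).
pose u n := (t (x n)).1.1; pose a n := (t (x n)).1.2.
have uP n : [/\ idempotent_elt (u n), f ([set x n], setT) (u n) &
    forall y, (a n <= y)%O -> exists v w : 'I_N -> R,
      point_ideal y (1 - \sum_i v i * u n * w i)].
  by have := tP (x n); have := xN n; rewrite /u /a; case: (t _) => -[? ?] ? /= ->.
pose m := (N * k + 1)%N.
have [|||s [g [a' [b [c [_ _ _ gg uc]]]]]] := @realization_orthogonal x u m.
- exact: x_inj.
- by move=> i; case: (uP i).
- by move=> i; case: (uP i).
(* A single point [y] is taken beyond all the thresholds [a n] and beyond [c]. *)
have [y0 ay0] := omega1_bounded omega1W a.
have [y [y0y cy]] := omega1_bounded2 omega1W y0 c.
have idy := point_ideal_is_ideal y.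
have /choice[vw vwP] n : exists vw : ('I_N -> R) * ('I_N -> R),
    point_ideal y (1 - \sum_i vw.1 i * u n * vw.2 i).
  have [_ _ /(_ y)[|v [w vw]]] := uP n; last by exists (v, w).
  by apply: ltW; apply: lt_trans y0y; exact: ay0.
apply: (@point_ideal_proper y).
(* Orthogonality of the [g i] kills the entries of [B *m A] off the diagonal; a diagonal entry is,
   modulo [point_ideal y], the sum of the [v j * u i.+1 * w j], hence 1. *)
pose A : 'M[R]_(N, m) := \matrix_(j, i) (g i * b i * (vw i.+1).2 j).
pose B : 'M[R]_(m, N) := \matrix_(i, j) ((vw i.+1).1 j * a' i * g i).
apply: (stable_rank_no_embedding idy (B := B) (A := A) srR) => i i'.
rewrite !mxE; under eq_bigr do rewrite !mxE.
have [<-{i'}|ii'] := eqVneq i i'; last first.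
  rewrite big1 ?subr0; first by case: idy.
  move=> j _; rewrite !mulrA -(mulrA _ (g i)) gg //.
  by rewrite (negPf (ii' : val i != val i')) mulr0 !mul0r.
have [v [w [vwE uvw]]] : exists v w, vw i.+1 = (v, w) /\
    point_ideal y (1 - \sum_j v j * u i.+1 * w j).
  by have := vwP i.+1; case: (vw i.+1) => v w; exists v, w.
rewrite vwE /=.
pose e := u i.+1 - a' i * g i * b i.
have -> : \sum_j v j * a' i * g i * (g i * b i * w j) - 1 =
    - (1 - \sum_j v j * u i.+1 * w j) - \sum_j v j * e * w j.
  rewrite opprB addrAC; congr (_ - 1); rewrite -sumrB; apply: eq_bigr => j _.
  rewrite /e mulrBr mulrBl opprB addrC subrK !mulrA.
  by rewrite -(mulrA _ (g i) (g i)) gg // eqxx.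
apply: (idealB idy); first exact: (idealN idy).
apply: (ideal_summ idy) => j; apply: (ideal_mulr idy); apply: (ideal_mull idy).
by apply: uc => //; exact: ltW.
Qed.

End Realization.

Theorem corollary6p2 (d : Order.disp_t) (W : orderType d)
    (omega1W : is_omega1 W) :
  ~ exists R : pzRingType,
      [/\ exchange_ring R, finite_stable_rank R
        & semilattice_isomorphic (@S_omega1 d W) (@S_join d W)
            (@compact_idempotent_generated_ideals R) (@ideal_sum R)].
Proof.
case=> R [exR [k [_ srR]] [f [f_bij f_join]]].
exact: (realization_infinite_stable_rank omega1W exR f_bij f_join srR).
Qed.
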